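(* If $q$ is odd and fixed, then, for each choice of sign in $\mathrm{SO}^{\pm}$, $$\lim_{m\to\infty}\frac{i(\mathrm{SO}^{\pm}(4m,q))}{q^{(2m)^2}}=\frac12\left(\prod_{i\ge 1}(1+1/q^{2i-1})^2+\prod_{i\ge 1}(1-1/q^{2i-1})^2\right),$$ and $$\lim_{m\to\infty}\frac{i(\mathrm{SO}^{\pm}(4m+2,q))}{q^{(2m+1)^2}}=\frac12\left(\prod_{i\ge 1}(1+1/q^{2i-1})^2-\prod_{i\ge 1}(1-1/q^{2i-1})^2\right).$$
   Context: For $q$ an odd prime power and $\delta$ a fixed nonsquare in $\mathbb{F}_q^{\times}$: $\mathrm{O}^{+}(2n,q)$ is the isometry group on $\mathbb{F}_q^{2n}$ of the quadratic form $x_1x_2+x_3x_4+\cdots+x_{2n-1}x_{2n}$, and $\mathrm{O}^{-}(2n,q)$ is that of $x_1x_2+\cdots+x_{2n-3}x_{2n-2}+x_{2n-1}^2-\delta x_{2n}^2$. $\mathrm{SO}^{\pm}(2n,q)$ is the subgroup of determinant $1$ elements of $\mathrm{O}^{\pm}(2n,q)$. $i(X)$ denotes the number of $g\in X$ with $g^2=1$ (the identity is counted). *)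

(* Defs.v *)
From HB Require Import structures.
From mathcomp Require Import all_boot all_order all_algebra.
From mathcomp Require Import all_classical all_reals all_analysis.
From mathcomp Require Import ring.

Set Implicit Arguments.
Unset Strict Implicit.
Unset Printing Implicit Defensive.

Import Order.TTheory GRing.Theory Num.Theory.
Import numFieldNormedType.Exports.

Local Open Scope classical_set_scope.
Local Open Scope ring_scope.

Variant sign := Plus | Minus.

Lemma fst_subproof n (i : 'I_n) : (2 * i < 2 * n)%N.
Proof. by rewrite ltn_mul2l /=. Qed.

Lemma snd_subproof n (i : 'I_n) : ((2 * i).+1 < 2 * n)%N.
Proof. by rewrite -[(2 * i).+1]addn1 !mul2n addn1 ltn_Sdouble. Qed.

(* With coordinates numbered from 1 as x_1, ..., x_{2n}, the ordinal i < n
   selects the pair (x_{2i+1}, x_{2i+2}). *)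
Definition ofst n (i : 'I_n) : 'I_(2 * n) := Ordinal (fst_subproof i).
Definition osnd n (i : 'I_n) : 'I_(2 * n) := Ordinal (snd_subproof i).

Section OrthogonalGroups.
Variable F : finFieldType.

Definition qform_plus n (x : 'cV[F]_(2 * n)) : F :=
  \sum_(i < n) x (ofst i) 0 * x (osnd i) 0.

(* The second sum has the single index i = n - 1 when n > 0; the form is 0 on
   the zero space when n = 0. *)
Definition qform_minus (delta : F) n (x : 'cV[F]_(2 * n)) : F :=
  \sum_(i < n | (i.+1 < n)%N) x (ofst i) 0 * x (osnd i) 0 +
  \sum_(i < n | i.+1 == n) (x (ofst i) 0 ^+ 2 - delta * x (osnd i) 0 ^+ 2).

Definition qform (delta : F) (eps : sign) n : 'cV[F]_(2 * n) -> F :=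
  match eps with
  | Plus => @qform_plus n
  | Minus => @qform_minus delta n
  end.

Definition isometries d (Q : 'cV[F]_d -> F) : {set 'M[F]_d} :=
  [set A : 'M[F]_d | (A \in unitmx) && [forall x, Q (A *m x) == Q x]].

Definition O_group (delta : F) (eps : sign) n : {set 'M[F]_(2 * n)} :=
  isometries (@qform delta eps n).

Definition SO_group (delta : F) (eps : sign) n : {set 'M[F]_(2 * n)} :=
  [set A in O_group delta eps n | \det A == 1].

Definition ninvol d (X : {set 'M[F]_d}) : nat :=
  #|[set A in X | A *m A == 1%:M]|.

End OrthogonalGroups.

Section InfiniteProducts.
Variable R : realType.

Definition infprod (a : nat -> R) : R :=
  limn (fun N => \prod_(1 <= i < N.+1) a i).

(* [lim] is total, so the next two facts record that [infprod] is not a default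
   value on the products it is used for. *)
Lemma is_cvg_infprod_plus (q : nat) : (1 < q)%N ->
  cvgn (fun N => \prod_(1 <= i < N.+1) (1 + 1 / q%:R ^+ (2 * i - 1)) ^+ 2 : R).
Proof.
move=> q1.
have q0 : 0 < q%:R :> R by rewrite ltr0n (ltn_trans _ q1).
have q2 : 2 <= q%:R :> R by rewrite (ler_nat R 2).
have h1 : (2^-1 : R) < 1 by rewrite invf_lt1 ?ltr0n// ltr1n.
have u0 i : 0 <= 1 / q%:R ^+ (2 * i - 1) :> R by rewrite divr_ge0 ?exprn_ge0 ?ltW.
have uexp i : (1 <= i)%N -> 1 / q%:R ^+ (2 * i - 1) <= 2^-1 ^+ i :> R.
  move=> i1; rewrite div1r -exprVn.
  apply: (@le_trans _ _ (q%:R^-1 ^+ i)).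
    apply: ler_wiXn2l; rewrite ?invr_ge0 ?ltW//; last first.
      by rewrite mul2n -addnn -addnBA// leq_addr.
    by rewrite invf_lt1// ltr1n.
  apply: lerXn2r; rewrite ?nnegrE ?invr_ge0 ?ler0n//.
  by rewrite lef_pV2 ?posrE// ltr0n.
have P0 N : 0 <= \prod_(1 <= i < N) (1 + 1 / q%:R ^+ (2 * i - 1)) ^+ 2 :> R.
  by apply: prodr_ge0 => i _; exact: sqr_ge0.
apply: nondecreasing_is_cvgn.
  apply/nondecreasing_seqP => N; rewrite [leRHS]big_nat_recr//=.
  by apply: ler_peMr => //; apply: exprn_ege1; rewrite lerDl.
exists (expR 2) => _ [N _ <-].
suff : \prod_(1 <= i < N.+1) (1 + 1 / q%:R ^+ (2 * i - 1)) ^+ 2 <=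
    expR (2 * (1 - 2^-1 ^+ N)) :> R.
  move=> /le_trans; apply; rewrite ler_expR; exact: ler_piMr.
elim: N => [|N IH]; first by rewrite big_nil subrr mulr0 expR0.
rewrite big_nat_recr//=.
have -> : 2 * (1 - 2^-1 ^+ N.+1) =
    2 * (1 - 2^-1 ^+ N) + 2%:R * 2^-1 ^+ N.+1 :> R.
  by rewrite exprS; field.
rewrite expRD; apply: ler_pM => //.
rewrite expRM_natl; apply: lerXn2r.
- by rewrite nnegrE addr_ge0.
- by rewrite nnegrE expR_ge0.
apply: le_trans (expR_ge1Dx _).
by rewrite lerD2l; exact: uexp.
Qed.

Lemma is_cvg_infprod_minus (q : nat) : (1 < q)%N ->
  cvgn (fun N => \prod_(1 <= i < N.+1) (1 - 1 / q%:R ^+ (2 * i - 1)) ^+ 2 : R).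
Proof.
move=> q1.
have q0 : 0 < q%:R :> R by rewrite ltr0n (ltn_trans _ q1).
have P0 N : 0 <= \prod_(1 <= i < N) (1 - 1 / q%:R ^+ (2 * i - 1)) ^+ 2 :> R.
  by apply: prodr_ge0 => i _; exact: sqr_ge0.
apply: nonincreasing_is_cvgn.
  apply/nonincreasing_seqP => N; rewrite [leLHS]big_nat_recr//=.
  rewrite ler_piMr// exprn_ile1//.
  by rewrite subr_ge0 div1r invf_le1 ?exprn_gt0// exprn_ege1// ler1n ltnW.
by exists 0 => _ [N _ <-].
Qed.

End InfiniteProducts.

(* Main.v *)
(** An involution of an orthogonal group is [1 - 2P] for a self-adjoint
    projection [P], and its determinant is [(-1) ^ rank P]; so i(SO) counts
    nondegenerate subspaces of even dimension.  In a nondegenerate space of even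
    dimension D, every nonzero u has exactly q^(D-1) partners v such that the
    Gram determinant of (u, v) vanishes, whatever the type of the form.  Hence
    the number of nondegenerate 2-frames depends only on D, and counting pairs
    (2-frame inside a nondegenerate 2a-space) in two ways shows, without Witt's
    theorem, that the number of nondegenerate 2a-subspaces in dimension 2n is
    q^(4a(n-a)) [n, a] with Gaussian binomials taken at y = p^2, p = 1/q.  Thus
    i(SO) / q^(n^2) is the sum over a of [n, a] p^((n-2a)^2).  By the finite
    Jacobi triple product, the sum of [2n, 2a] p^((n-2a)^2) over a is
    (prod_(i<=n) (1 + p^(2i-1))^2 + (-1)^n prod_(i<=n) (1 - p^(2i-1))^2) / 2.
    Since [n, a] and [2n, 2a] differ by at most 16 p^(2 min(a, n-a)), the two
    sums differ by O(n p^n). *)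

Require Import Defs.
From mathcomp Require Import all_boot all_order all_algebra all_field.
From mathcomp Require Import all_classical all_reals all_analysis.
From mathcomp Require Import ring zify lra.
Set Implicit Arguments.
Unset Strict Implicit.
Unset Printing Implicit Defensive.
Import Order.TTheory GRing.Theory Num.Theory.
Import numFieldNormedType.Exports.
Local Open Scope ring_scope.


(** * Determinants and ranks of idempotent matrices *)

(** Both sides are the determinant of the block matrix with rows [1, -A] and [B, 1], read off from
    its two factorizations into block triangular matrices. *)
Lemma det_sylvester (R : comPzRingType) m n
    (A : 'M[R]_(m, n)) (B : 'M[R]_(n, m)) :
  \det (1%:M + A *m B) = \det (1%:M + B *m A).
Proof.
have E1 : block_mx 1%:M (- A) B 1%:M =
    block_mx 1%:M 0 B 1%:M *m block_mx 1%:M (- A) 0 (1%:M + B *m A).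
  rewrite mulmx_block !mul1mx !mul0mx !mulmx1 !addr0 mulmxN.
  by rewrite [1%:M + _]addrC addKr.
have E2 : block_mx 1%:M (- A) B 1%:M =
    block_mx (1%:M + A *m B) (- A) 0 1%:M *m block_mx 1%:M 0 B 1%:M.
  by rewrite mulmx_block !mul1mx !mul0mx !mulmx0 !mulmx1 ?add0r mulNmx ?addrK.
have := congr1 determinant E1; rewrite E2 !det_mulmx.
rewrite !(det_ublock, det_lblock) !det1.
by rewrite !mul1r !mulr1.
Qed.

Lemma det_mx11_block (R : comNzRingType) (M : 'M[R]_(1 + 1)) :
  \det M = M (lshift 1 0) (lshift 1 0) * M (rshift 1 0) (rshift 1 0)
    - M (lshift 1 0) (rshift 1 0) * M (rshift 1 0) (lshift 1 0).
Proof.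
have e0 : ord0 = lshift 1 (0 : 'I_1) :> 'I_(1 + 1) by apply/val_inj.
have e1 : lift ord0 ord0 = rshift 1 (0 : 'I_1) :> 'I_(1 + 1) by apply/val_inj.
have e2 : lift (rshift 1 0) 0 = lshift 1 (0 : 'I_1) :> 'I_(1 + 1) by apply/val_inj.
rewrite (expand_det_row _ ord0) !big_ord_recl big_ord0 /cofactor !det_mx11 !mxE.
rewrite !e1 e2 -e0 /= expr0 expr1 mul1r mulN1r mulrN addr0.
by [].
Qed.

Section Idempotents.
Variables (F : fieldType) (d : nat).
Implicit Types P Q : 'M[F]_d.

(** With [P = C *m R] a full-rank factorization, [C R C R = C R] allows cancelling [C] on the left
    and [R] on the right. *)
Lemma idempotent_base P : P *m P = P -> row_base P *m col_base P = 1%:M.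
Proof.
have /row_fullP[L] := col_base_full P; have /row_freeP[K] := row_base_free P.
move: (row_base P) (col_base P) (mulmx_base P) => R C CR RK LC PP.
have /(congr1 (mulmx L)) : C *m R *m (C *m R) = C *m R by rewrite CR.
 rewrite !mulmxA LC !mul1mx => /(congr1 (mulmx^~ K)).
by rewrite -mulmxA RK mulmx1.
Qed.

(** Sylvester's identity moves the determinant to size [\rank P], where the matrix becomes
    [1 - 2 = -1] times the identity. *)
Lemma det_reflection P : P *m P = P -> \det (1%:M - P *+ 2) = (-1) ^+ \rank P.
Proof.
move=> PP.
have -> : 1%:M - P *+ 2 = 1%:M + (- (2%:R *: col_base P)) *m row_base P.
  by rewrite mulNmx -scalemxAl mulmx_base scaler_nat.
rewrite det_sylvester mulmxN -scalemxAr (idempotent_base PP) scaler_nat.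
have -> : 1%:M - 1%:M *+ 2 = (-1)%:M :> 'M[F]_(\rank P).
  by rewrite mulr2n opprD addrA subrr sub0r rmorphN.
by rewrite det_scalar.
Qed.

Lemma mxrankB_idempotent P Q :
    P *m P = P -> Q *m Q = Q -> P *m Q = P -> Q *m P = P ->
  \rank Q = (\rank P + \rank (Q - P)%R)%N.
Proof.
move=> PP QQ PQ QP.
have PD : P *m (Q - P) = 0 by rewrite mulmxBr PQ PP subrr.
(* Right multiplication by [P] fixes the row space of [P] and kills that of [Q - P]. *)
have capP : (P :&: (Q - P)%R)%MS = 0.
  apply/eqP; rewrite -submx0; apply/rV_subP => v.
  rewrite sub_capmx => /andP[/submxP[x ->] /submxP[y]].
  move=> E; have : x *m P *m P = 0.
    rewrite E -mulmxA; have -> : (Q - P) *m P = 0 by rewrite mulmxBl QP PP subrr.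
    by rewrite mulmx0.
  by rewrite -mulmxA PP => ->; rewrite sub0mx.
rewrite -(mxrank_disjoint_sum capP); apply/eqP.
rewrite eqn_leq; apply/andP; split; apply: mxrankS.
  have {1}-> : Q = P + (Q - P) by rewrite addrC subrK.
  exact: addmx_sub_adds.
rewrite addsmx_sub -{1}PQ submxMl /=; apply: addmx_sub => //.
by rewrite eqmx_opp -PQ submxMl.
Qed.

End Idempotents.

Lemma card_idempotent_image (F : finFieldType) d (Q : 'M[F]_d) :
  Q *m Q = Q -> #|[set x : 'cV[F]_d | Q *m x == x]| = (#|F| ^ \rank Q)%N.
Proof.
move=> QQ; have RC := idempotent_base QQ.
have CI : injective (mulmx (col_base Q) : 'cV_(\rank Q) -> 'cV_d).
  by apply: (can_inj (g := mulmx (row_base Q))) => x; rewrite mulmxA RC mul1mx.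
transitivity #|[set: 'cV[F]_(\rank Q)]|; last by rewrite cardsT card_mx muln1.
rewrite -(card_imset _ CI); apply: eq_card => x; rewrite inE; apply/eqP/imsetP.
  by move=> Qx; exists (row_base Q *m x) => //; rewrite mulmxA mulmx_base.
case=> y _ ->; rewrite -{1}(mulmx_base Q) -mulmxA [row_base Q *m _]mulmxA RC.
by rewrite mul1mx.
Qed.

(** * Binary diagonal forms over a finite field of odd order *)

Section FiniteFieldForms.
Variable F : finFieldType.
Hypothesis odd_F : odd #|F|.
Implicit Types a b c e : F.

(** Each value is taken at most twice, at [x] and [- x], so at least half of the field is reached;
    equality is excluded because [#|F|] is odd. *)
Lemma card_affine_squares a b : a != 0 ->
  (#|F| < #|[set (a * x ^+ 2 + b)%R | x : F]| * 2)%N.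
Proof.
move=> a0; set S := [set _ | _ : F]; have : (#|F| <= #|S| * 2)%N.
  rewrite -[X in (X <= _)%N]sum1_card.
  rewrite (partition_big (fun x => a * x ^+ 2 + b) (mem S)) /=; last first.
    by move=> x _; apply/imsetP; exists x.
  rewrite -sum_nat_const; apply: leq_sum => _ /imsetP[x _ ->].
  rewrite sum1_card (leq_trans (n := #|[set x; (- x)%R]|)) //; last first.
    by rewrite cards2; case: eqP.
  apply/subset_leq_card/fintype.subsetP => y; rewrite !inE /= unfold_in /=.
  by move=> /eqP /addIr /(mulfI a0) /eqP; rewrite eqf_sqr.
by rewrite leq_eqVlt => /orP[/eqP E|//]; move: odd_F; rewrite E oddM andbF.
Qed.

(** Pigeonhole: the values of [a x^2] and of [e - b y^2] each fill more than half of the field, so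
    they meet. *)
Lemma binary_form_represents a b e : a != 0 -> b != 0 ->
  exists z : F * F, a * z.1 ^+ 2 + b * z.2 ^+ 2 = e.
Proof.
move=> a0 b0.
set A := [set a * x ^+ 2 + 0 | x : F]; set B := [set - b * x ^+ 2 + e | x : F].
have [/eqP AB|/set0Pn[w]] := boolP (A :&: B == finset.set0).
  have : (#|F| * 2 < (#|A| + #|B|) * 2)%N.
    have nb0 : - b != 0 by rewrite oppr_eq0.
    rewrite mulnDl muln2 -addnn -addSn leq_add ?card_affine_squares //.
    by rewrite ltnW // card_affine_squares.
  rewrite ltn_pmul2r // -cardsUI AB cards0 addn0 ltnNge.
  by rewrite max_card.
rewrite inE => /andP[/imsetP[x _ ->] /imsetP[y _ E]]; exists (x, y) => /=.
by rewrite -[a * _]addr0 E; ring.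
Qed.

Definition binary_count a b e : nat :=
  #|[set z : F * F | a * z.1 ^+ 2 + b * z.2 ^+ 2 == e]|.

(* The form is a times the norm form X^2 + (b/a) Y^2; multiplication by an
   element of norm e'/e carries the level set of e into that of e'. *)
Lemma binary_count_nonzero a b e e' : a != 0 -> b != 0 -> e != 0 -> e' != 0 ->
  binary_count a b e = binary_count a b e'.
Proof.
move=> a0 b0; wlog suff le_count : e e' / e != 0 -> e' != 0 ->
    (binary_count a b e <= binary_count a b e')%N => [e0 e'0|e0 e'0].
  by apply/eqP; rewrite eqn_leq !le_count.
have ba0 : b / a != 0 by rewrite mulf_neq0 ?invr_neq0.
have [[s t] /= st] := binary_form_represents (e' / e) (oner_neq0 F) ba0.
have st0 : s ^+ 2 + b / a * t ^+ 2 != 0.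
  by rewrite -[s ^+ 2]mul1r st mulf_neq0 ?invr_neq0.
pose f (z : F * F) := (s * z.1 - b / a * t * z.2, t * z.1 + s * z.2).
have f_inj : injective f.
  (* The inverse of [f]: multiplication by the conjugate of [(s, t)], divided by its norm. *)
  pose g (z : F * F) := ((s * z.1 + b / a * t * z.2) / (s ^+ 2 + b / a * t ^+ 2),
     (s * z.2 - t * z.1) / (s ^+ 2 + b / a * t ^+ 2)).
  apply: (can_inj (g := g)) => -[x y]; rewrite /f /g /=.
  congr (_, _); apply: (canLR (mulfK st0)); ring.
rewrite /binary_count -(card_imset _ f_inj); apply/subset_leq_card/fintype.subsetP.
move=> _ /imsetP[[x y] /[!inE] /= /eqP xy ->] /=; apply/eqP.
transitivity (e * (1 * s ^+ 2 + b / a * t ^+ 2)); last by rewrite st; field.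
by rewrite -xy; field.
Qed.

Lemma sum_binary_count a b : (\sum_e binary_count a b e = #|F| ^ 2)%N.
Proof.
rewrite expnS expn1 -card_prod -sum1_card.
rewrite (partition_big (fun z : F * F => a * z.1 ^+ 2 + b * z.2 ^+ 2) predT) //=.
by apply: eq_bigr => e _; rewrite sum1_card; apply: eq_card => z; rewrite inE.
Qed.

Lemma two_neq0 : (2 : F) != 0.
Proof.
apply/negP => /eqP two0; have ch : 2%N \in [pchar F] by rewrite inE /= two0 eqxx.
have := odd_F; rewrite (card_pprimeChar ch) oddX orbF => /eqP n0.
by have := finNzRing_gt1 F; rewrite (card_pprimeChar ch) n0.
Qed.

End FiniteFieldForms.
(** * Self-adjoint projections *)

Section SelfAdjointProjections.
Variables (F : finFieldType) (d : nat) (J : 'M[F]_d).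
Hypotheses (J_sym : J^T = J) (J_unit : J \in unitmx).
Implicit Types (P Q : 'M[F]_d) (u v x y : 'cV[F]_d) (c e : F).

Definition bil u v : F := (u^T *m J *m v) 0 0.

Lemma bilC u v : bil u v = bil v u.
Proof.
by rewrite /bil -[u^T *m J *m v]trmxK mxE !trmx_mul J_sym trmxK mulmxA.
Qed.

Lemma bilDr u v x : bil u (v + x) = bil u v + bil u x.
Proof. by rewrite /bil mulmxDr mxE. Qed.

Lemma bilDl u v x : bil (u + v) x = bil u x + bil v x.
Proof. by rewrite bilC bilDr !(bilC x). Qed.

Lemma bilZr c u v : bil u (c *: v) = c * bil u v.
Proof. by rewrite /bil -scalemxAr mxE. Qed.

Lemma bilZl c u v : bil (c *: u) v = c * bil u v.
Proof. by rewrite bilC bilZr bilC. Qed.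

Lemma bil0l v : bil 0 v = 0.
Proof. by rewrite -(scale0r (0 : 'cV_d)) bilZl mul0r. Qed.

(** A nondegenerate subspace is encoded by its orthogonal projection; inclusion of images then reads
    [Q *m P = P], and the relative orthogonal complement is [Q - P]. *)
Definition selfadj_proj P := (P *m P == P) && (P^T *m J == J *m P).

Lemma selfadj_projP P : reflect (P *m P = P /\ P^T *m J = J *m P) (selfadj_proj P).
Proof. by apply: (iffP andP) => [[/eqP ? /eqP ?]|[-> ->]]. Qed.
Arguments selfadj_projP {P}.

Lemma selfadj_proj1 : selfadj_proj 1%:M.
Proof. by apply/selfadj_projP; rewrite mul1mx trmx1 mul1mx mulmx1. Qed.

Lemma bil_proj P u v : selfadj_proj P -> bil (P *m u) v = bil u (P *m v).
Proof.
by case/selfadj_projP=> _ PJ; rewrite /bil trmx_mul -[_ *m P^T *m J]mulmxA PJ !mulmxA.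
Qed.

(** Passing to adjoints reverses the product in [Q *m P = P]; the invertible [J] can then be
    cancelled. *)
Lemma proj_le_commute P Q : selfadj_proj P -> selfadj_proj Q ->
  Q *m P = P -> P *m Q = P.
Proof.
move=> /selfadj_projP[_ PJ] /selfadj_projP[_ QJ] QP.
apply: (can_inj (mulKmx J_unit)).
by rewrite mulmxA -PJ -mulmxA -QJ mulmxA -trmx_mul QP.
Qed.

Lemma selfadj_projB P Q : selfadj_proj P -> selfadj_proj Q -> Q *m P = P ->
  selfadj_proj (Q - P).
Proof.
move=> sP sQ QP; have PQ := proj_le_commute sP sQ QP.
case/selfadj_projP: sP => PP PJ; case/selfadj_projP: sQ => QQ QJ.
apply/selfadj_projP; split.
  by rewrite mulmxBl !mulmxBr QQ QP PQ PP subrr subr0.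
by rewrite linearB /= mulmxBl mulmxBr PJ QJ.
Qed.

Lemma selfadj_projD P Q : selfadj_proj P -> selfadj_proj Q -> Q *m P = 0 ->
  selfadj_proj (Q + P).
Proof.
move=> /selfadj_projP[PP PJ] /selfadj_projP[QQ QJ] QP.
have PQ : P *m Q = 0.
  apply: (can_inj (mulKmx J_unit)).
  by rewrite mulmxA -PJ -mulmxA -QJ mulmxA -trmx_mul QP trmx0 mul0mx mulmx0.
apply/selfadj_projP; split.
  by rewrite mulmxDl !mulmxDr QQ QP PQ PP addr0 add0r.
by rewrite linearD /= mulmxDl mulmxDr PJ QJ.
Qed.

Lemma mxrank_projB P Q : selfadj_proj P -> selfadj_proj Q -> Q *m P = P ->
  \rank Q = (\rank P + \rank (Q - P)%R)%N.
Proof.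
move=> sP sQ QP; have PQ := proj_le_commute sP sQ QP.
case/selfadj_projP: sP => PP _; case/selfadj_projP: sQ => QQ _.
exact: mxrankB_idempotent.
Qed.

(** * Orthogonal projection onto the span of a frame *)

Section Frames.
Variables (k : nat) (X : 'M[F]_(d, k)).

(* The columns of X span the image; [frame_proj] is the orthogonal projection
   onto it when the Gram matrix is invertible. *)
Definition gram := X^T *m J *m X.
Definition frame_proj := X *m invmx gram *m X^T *m J.

Hypothesis gram_unit : gram \in unitmx.

Lemma frame_projK : frame_proj *m X = X.
Proof.
by rewrite /frame_proj -!mulmxA [X^T *m _]mulmxA -/gram mulVmx // mulmx1.
Qed.

Lemma frame_proj_selfadj : selfadj_proj frame_proj.
Proof.
apply/selfadj_projP; split.
  by rewrite {2}/frame_proj !mulmxA frame_projK.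
have gram_sym : gram^T = gram by rewrite /gram !trmx_mul trmxK J_sym mulmxA.
by rewrite /frame_proj !trmx_mul trmxK J_sym trmx_inv gram_sym !mulmxA.
Qed.

Lemma frame_proj_le Q : Q *m X = X -> Q *m frame_proj = frame_proj.
Proof. by rewrite /frame_proj !mulmxA => ->. Qed.

Lemma mxrank_frame_proj : \rank frame_proj = k.
Proof.
apply/eqP; rewrite eqn_leq; apply/andP; split.
  rewrite /frame_proj -!mulmxA (leq_trans (mxrankM_maxl _ _)) //.
  exact: rank_leq_col.
(* The lower bound holds because the invertible Gram matrix factors through [frame_proj]. *)
have -> : k = \rank gram by rewrite mxrank_unit.
rewrite /gram -frame_projK mulmxA (leq_trans (mxrankM_maxl _ _)) //.
exact: mxrankM_maxr.
Qed.

End Frames.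

Lemma gram_col u : (gram u \in unitmx) = (bil u u != 0).
Proof. by rewrite unitmxE det_mx11 unitfE. Qed.

Lemma frame_proj_col u x : bil u u != 0 ->
  frame_proj u *m x = (bil u x / bil u u) *: u.
Proof.
move=> u0; rewrite /frame_proj -!mulmxA.
have -> : invmx (gram u) = (bil u u)^-1%:M.
  by rewrite [gram u]mx11_scalar invmx_scalar.
rewrite [u^T *m _]mulmxA [_ *m x]mx11_scalar -/(bil u x) -scalar_mxM.
by rewrite mul_mx_scalar mulrC.
Qed.


(** * Anisotropic vectors and the number of isotropic vectors in odd rank *)

Hypothesis odd_F : odd #|F|.

Definition isotropic_count Q : nat :=
  #|[set x | (Q *m x == x) && (bil x x == 0)]|.

(** Otherwise polarization, with [2] invertible, makes [bil] vanish on the image of [Q];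
    self-adjointness then gives [J *m Q = 0], hence [Q = 0]. *)
Lemma exists_anisotropic Q : selfadj_proj Q -> Q != 0 ->
  exists2 u, Q *m u = u & bil u u != 0.
Proof.
move=> sQ Q0; have [QQ QJ] := selfadj_projP sQ.
have [/existsP[u /andP[/eqP]]|iso] :=
  boolP [exists u, (Q *m u == u) && (bil u u != 0)]; first by exists u.
have {}iso u : bil (Q *m u) (Q *m u) = 0.
  move: iso; rewrite negb_exists => /forallP /(_ (Q *m u)).
  by rewrite mulmxA QQ eqxx /= negbK => /eqP.
have bil0 u v : bil u (Q *m v) = 0.
  have := iso (u + v); rewrite mulmxDr bilDl !bilDr !iso add0r addr0.
  rewrite [bil (Q *m v) _]bilC -mulr2n -mulr_natr => /eqP.
  by rewrite mulf_eq0 (negPf (two_neq0 odd_F)) orbF bil_proj // mulmxA QQ => /eqP.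
case/eqP: Q0; apply: (can_inj (mulKmx J_unit)); rewrite mulmx0.
apply/matrixP=> i j; rewrite [RHS]mxE -(bil0 (delta_mx i 0) (delta_mx j 0)).
rewrite /bil trmx_delta mulmxA -[_ *m J *m Q]mulmxA -rowE -colE.
by rewrite !mxE.
Qed.

Section AnisotropicVector.
Variables (Q : 'M[F]_d) (u : 'cV[F]_d).
Hypotheses (sQ : selfadj_proj Q) (Qu : Q *m u = u) (u_aniso : bil u u != 0).

Let Q' := Q - frame_proj u.

Lemma selfadj_proj_orth : selfadj_proj Q'.
Proof.
by apply: selfadj_projB; rewrite ?frame_proj_le // frame_proj_selfadj // gram_col.
Qed.

Lemma mxrank_orth : \rank Q = (\rank Q').+1.
Proof.
have gu : gram u \in unitmx by rewrite gram_col.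
rewrite (mxrank_projB (frame_proj_selfadj gu) sQ) ?mxrank_frame_proj //.
exact: frame_proj_le.
Qed.

Lemma orth_le x : Q' *m x = x -> Q *m x = x.
Proof.
have [QQ _] := selfadj_projP sQ; move=> <-.
by rewrite mulmxA /Q' mulmxBr QQ frame_proj_le.
Qed.

Lemma bil_orth x : Q' *m x = x -> bil u x = 0.
Proof.
move=> <-; rewrite -(bil_proj _ _ selfadj_proj_orth) /Q' mulmxBl Qu.
by rewrite frame_projK ?gram_col // subrr bil0l.
Qed.

(** The image of [Q] is the orthogonal sum of the line of [u] and the image of [Q']; the coordinate
    on [u] is [bil u x / bil u u]. *)
Lemma sum_split_vector (g : 'cV[F]_d -> nat) :
  (\sum_(x | Q *m x == x) g x =
   \sum_(c : F) \sum_(y | Q' *m y == y) g (c *: u + y)%R)%N.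
Proof.
rewrite pair_big_dep /=.
rewrite (reindex_onto (fun z : F * 'cV_d => z.1 *: u + z.2)
   (fun x => (bil u x / bil u u, Q' *m x))) /=; last first.
  move=> x /eqP Qx; rewrite /Q' mulmxBl Qx frame_proj_col // addrC subrK //.
apply: eq_bigl => -[c y] /=; apply/andP/eqP => [[_ /eqP[_ E]]|Qy].
  have Q'u : Q' *m u = 0.
    by rewrite /Q' mulmxBl Qu frame_projK ?gram_col // subrr.
  by rewrite -[in RHS]E mulmxDr -scalemxAr Q'u scaler0 add0r.
have Q'u : Q' *m u = 0.
  by rewrite /Q' mulmxBl Qu frame_projK ?gram_col // subrr.
rewrite !mulmxDr -!scalemxAr Qu (orth_le Qy) Q'u Qy scaler0 add0r bilDr bilZr.
by rewrite (bil_orth Qy) addr0 mulfK.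
Qed.

Lemma bil_split c y : Q' *m y = y ->
  bil (c *: u + y) (c *: u + y) = bil u u * c ^+ 2 + bil y y.
Proof.
move=> /bil_orth uy; rewrite bilDl !bilDr !bilZl !bilZr [bil y u]bilC uy.
by ring.
Qed.

End AnisotropicVector.

(** Induction splitting off two orthogonal anisotropic vectors [u], [v]. The remaining component [y]
    leaves [N0] choices of coefficients if it is isotropic and [K] otherwise. The induction
    hypothesis counts both kinds of [y], and only the combination [N0 + (#|F| - 1) * K = #|F| ^ 2]
    enters, not the type of the binary form. *)
Lemma isotropic_count_odd m Q : selfadj_proj Q -> \rank Q = (2 * m).+1 ->
  isotropic_count Q = (#|F| ^ (2 * m))%N.
Proof.
elim: m Q => [|m IHm] Q sQ rQ.
- have [|u Qu u0] := exists_anisotropic sQ; first by rewrite -mxrank_eq0 rQ.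
  rewrite muln0 expn0 /isotropic_count.
  have rQ' := mxrank_orth sQ Qu u0; rewrite rQ in rQ'.
  have Q'0 : Q - frame_proj u = 0 by apply/eqP; rewrite -mxrank_eq0; move: rQ'; lia.
  rewrite (_ : [set x | _] = [set 0]) ?cards1 //; apply/setP => x; rewrite !inE.
  apply/andP/eqP => [[/eqP Qx x0]|->]; last by rewrite mulmx0 bil0l.
  have xu : x = (bil u x / bil u u) *: u.
    by rewrite -frame_proj_col // -{1}Qx; rewrite (subr0_eq Q'0).
  move: x0; rewrite xu bilZl bilZr !mulf_eq0 (negPf u0) orbF orbb.
  by rewrite -mulf_eq0 => /eqP ->; rewrite scale0r.
have [|u Qu u0] := exists_anisotropic sQ; first by rewrite -mxrank_eq0 rQ.
have sQ1 := selfadj_proj_orth sQ Qu u0; have rQ1 := mxrank_orth sQ Qu u0.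
set Q1 := Q - _ in sQ1 rQ1.
have [|v Q1v v0] := exists_anisotropic sQ1.
  by rewrite -mxrank_eq0; move: rQ1; rewrite rQ; lia.
have sQ2 := selfadj_proj_orth sQ1 Q1v v0; have rQ2 := mxrank_orth sQ1 Q1v v0.
set Q2 := Q1 - _ in sQ2 rQ2.
have {}rQ2 : \rank Q2 = (2 * m).+1 by move: rQ1; rewrite rQ rQ2; lia.
pose K := binary_count (bil u u) (bil v v) 1.
pose N0 := binary_count (bil u u) (bil v v) 0.
(* All nonzero values of the binary form are taken equally often, namely [K] times. *)
have N0K : (N0 + (#|F| - 1) * K = #|F| ^ 2)%N.
  rewrite -(sum_binary_count (bil u u) (bil v v)) (bigD1 0) //=; congr (_ + _)%N.
  rewrite (eq_bigr (fun=> K)); last first.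
    by move=> e e0; apply: binary_count_nonzero => //; exact: oner_neq0.
  rewrite sum_nat_const; congr (_ * _)%N.
  by rewrite subn1 -(cardC1 (0 : F)); apply: eq_card.
have Z2 := IHm Q2 sQ2 rQ2.
have -> : isotropic_count Q =
    (\sum_(y | Q2 *m y == y) binary_count (bil u u) (bil v v) (- bil y y))%N.
  rewrite /isotropic_count -sum1_card.
  rewrite (eq_bigl (fun x => (Q *m x == x) && (bil x x == 0))) => [|x]; last first.
    by rewrite inE.
  rewrite big_mkcondr /= (sum_split_vector sQ Qu u0).
  transitivity (\sum_c \sum_c' \sum_(y | Q2 *m y == y)
      (bil (c *: u + (c' *: v + y)) (c *: u + (c' *: v + y)) == 0)%R)%N.
    apply: eq_bigr => c _; rewrite -/Q1 (sum_split_vector sQ1 Q1v v0) -/Q2.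
    by apply: eq_bigr => c' _; apply: eq_bigr => y _; case: eqP.
  under [LHS]eq_bigr => c _ do rewrite exchange_big /=.
  rewrite exchange_big /=; apply: eq_bigr => y /eqP Q2y.
  rewrite /binary_count -sum1_card pair_bigA /= [RHS]big_mkcond /=.
  apply: eq_bigr => -[c e] _; rewrite inE /=.
  rewrite (bil_split sQ Qu u0); last first.
    by rewrite mulmxDr -scalemxAr Q1v (orth_le sQ1 Q1v Q2y).
  by rewrite (bil_split sQ1 Q1v v0) // addrA addr_eq0.
rewrite (bigID (fun y => bil y y == 0)) /=.
rewrite (eq_bigr (fun=> N0)); last by move=> y /andP[_ /eqP->]; rewrite oppr0.
rewrite [X in (_ + X)%N](eq_bigr (fun=> K)); last first.
  move=> y /andP[_ y0]; apply: binary_count_nonzero => //; last exact: oner_neq0.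
  by rewrite oppr_eq0.
rewrite !sum_nat_const.
have [QQ2 _] := selfadj_projP sQ2.
have := card_idempotent_image QQ2.
rewrite -(cardsID [set x | bil x x == 0]) rQ2.
(* [A] counts the isotropic and [B] the anisotropic vectors in the image of [Q2]. *)
set A := #|_ :&: _|; set B := #|_ :\: _|.
have -> : #|[pred x | (Q2 *m x == x) && (bil x x == 0)]| = A.
  by apply: eq_card => x; rewrite !inE.
have -> : #|[pred x | (Q2 *m x == x) && (bil x x != 0)]| = B.
  by apply: eq_card => x; rewrite !inE andbC.
have -> : A = (#|F| ^ (2 * m))%N.
  by rewrite -Z2; apply: eq_card => x; rewrite !inE.
move=> AB; have -> : B = (#|F| ^ (2 * m) * (#|F| - 1))%N.
  by rewrite mulnBr muln1 -expnSr -AB addKn.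
by rewrite -mulnA -mulnDr N0K -expnD; congr (_ ^ _)%N; lia.
Qed.

(** * Counting nondegenerate 2-frames and nondegenerate subspaces *)

(** The width [1 + 1] is that of [row_mx u v] for two column vectors. *)
Definition is_frame Q (X : 'M[F]_(d, 1 + 1)) := (Q *m X == X) && (gram X \in unitmx).

Lemma gram_row_mx u v :
  (gram (row_mx u v) \in unitmx) = (bil u u * bil v v - bil u v ^+ 2 != 0).
Proof.
rewrite unitmxE unitfE det_mx11_block; congr (_ != 0).
rewrite /gram tr_row_mx mul_col_mx mul_col_row.
rewrite block_mxEul block_mxEur block_mxEdl block_mxEdr.
by rewrite -!/(bil _ _) [bil v u]bilC expr2.
Qed.

(** Nondegeneracy supplies [w] in the image with [bil u w != 0], even for isotropic [u]; the image
    is then the direct sum of the line of [w] and the kernel of [bil u]. *)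
Lemma card_orthogonal_vectors Q u : selfadj_proj Q -> Q *m u = u -> u != 0 ->
  #|[set v | (Q *m v == v) && (bil u v == 0)]| = (#|F| ^ (\rank Q).-1)%N.
Proof.
move=> sQ Qu u0; have [QQ _] := selfadj_projP sQ.
have [w Qw uw] : exists2 w, Q *m w = w & bil u w != 0.
  have [/existsP[w /andP[/eqP]]|bil0] :=
    boolP [exists w, (Q *m w == w) && (bil u w != 0)]; first by exists w.
  case/eqP: u0; apply: trmx_inj; rewrite trmx0.
  apply: (can_inj (mulmxK J_unit)); rewrite mul0mx.
  apply/rowP=> j; rewrite [RHS]mxE; move: bil0; rewrite negb_exists.
  move=> /forallP/(_ (Q *m delta_mx j 0)); rewrite mulmxA QQ eqxx negbK.
  by rewrite -bil_proj // Qu /bil -colE mxE => /eqP.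
have rQ0 : (0 < \rank Q)%N.
  rewrite lt0n mxrank_eq0; apply: contra u0 => /eqP Q0.
  by rewrite -Qu Q0 mul0mx.
have q0 : (0 < #|F|)%N by apply/card_gt0P; exists 0.
apply/eqP; rewrite -(eqn_pmul2l q0) -expnS prednK //.
rewrite -(card_idempotent_image QQ) -cardsT -cardsX.
have -> : [set x | Q *m x == x] = (fun z : F * 'cV[F]_d => z.1 *: w + z.2) @:
    finset.setX [set: F]%SET [set v | (Q *m v == v) && (bil u v == 0)].
  apply/setP => x; rewrite !inE; apply/eqP/imsetP => [Qx|[[c y]]].
    exists (bil u x / bil u w, x - (bil u x / bil u w) *: w); last first.
      by rewrite /= addrC subrK.
    rewrite !inE /= mulmxBr -scalemxAr Qx Qw eqxx /=.
    by rewrite bilDr -scaleNr bilZr mulNr divfK // subrr.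
  by rewrite !inE /= => /andP[/eqP Qy _] ->; rewrite mulmxDr -scalemxAr Qw Qy.
rewrite card_in_imset // => -[c y] [c' y'].
rewrite !inE /= => /andP[_ /eqP y0] /andP[_ /eqP y'0] E.
have := congr1 (bil u) E; rewrite !bilDr !bilZr y0 y'0 !addr0 => /(mulIf uw) cc.
by move: E; rewrite cc => /addrI ->.
Qed.

(** The factors count a nonzero first vector and its partners with nonzero Gram determinant. At
    [D = 0] the product is [0]. *)
Definition frame_count D : nat := (#|F| ^ D - 1) * (#|F| ^ D - #|F| ^ D.-1).

(* For isotropic u the condition reads v _|_ u; otherwise it says that the
   component of v in the odd-dimensional space orthogonal to u is isotropic.
   Both counts are q^(2n-1): the type of the form does not enter. *)
Lemma card_degenerate_partners n Q u : selfadj_proj Q -> \rank Q = (2 * n)%N ->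
    Q *m u = u -> u != 0 ->
  #|[set v | (Q *m v == v) && (bil u u * bil v v - bil u v ^+ 2 == 0)]| =
  (#|F| ^ (2 * n).-1)%N.
Proof.
move=> sQ rQ Qu u0; have [uu0|uu] := eqVneq (bil u u) 0.
  rewrite -rQ -(card_orthogonal_vectors sQ Qu u0); apply: eq_card => v.
  by rewrite !inE uu0 mul0r sub0r oppr_eq0 expf_eq0.
have sQ' := selfadj_proj_orth sQ Qu uu; have rQ' := mxrank_orth sQ Qu uu.
have n0 : (0 < n)%N by move: rQ'; rewrite rQ; lia.
have {}rQ' : \rank (Q - frame_proj u) = (2 * n.-1).+1 by move: rQ'; rewrite rQ; lia.
rewrite -sum1_card.
rewrite (eq_bigl (fun v =>
  (Q *m v == v) && (bil u u * bil v v - bil u v ^+ 2 == 0))) => [|v]; last first.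
  by rewrite inE.
rewrite big_mkcondr /= (sum_split_vector sQ Qu uu).
rewrite (eq_bigr (fun=> isotropic_count (Q - frame_proj u))) => [|c _].
  rewrite (isotropic_count_odd sQ' rQ') sum_nat_const -expnS; congr (_ ^ _)%N; lia.
rewrite /isotropic_count -sum1_card -big_mkcondr /=; apply: eq_bigl => y.
rewrite inE; apply: andb_id2l => /eqP Qy; rewrite (bil_split sQ Qu uu) //.
rewrite bilDr bilZr (bil_orth sQ Qu uu Qy) addr0.
have -> : bil u u * (bil u u * c ^+ 2 + bil y y) - (c * bil u u) ^+ 2 =
   bil u u * bil y y by ring.
by rewrite mulf_eq0 (negPf uu).
Qed.

Lemma card_frames n Q : selfadj_proj Q -> \rank Q = (2 * n)%N ->
  #|[set X | is_frame Q X]| = frame_count (2 * n).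
Proof.
move=> sQ rQ; have [QQ _] := selfadj_projP sQ.
rewrite -sum1_card.
rewrite (reindex (fun z : 'cV[F]_d * 'cV[F]_d => row_mx z.1 z.2)) /=; last first.
  exists (fun X => (lsubmx X, rsubmx X)) => [[u v]|X] _ /=.
    by rewrite row_mxKl row_mxKr.
  exact: hsubmxK.
(* The condition [z.1 != 0] may be added since a zero first vector has Gram determinant [0]. *)
rewrite (eq_bigl (fun z : 'cV[F]_d * 'cV[F]_d =>
   ((Q *m z.1 == z.1) && (z.1 != 0)) && ((Q *m z.2 == z.2) &&
   (bil z.1 z.1 * bil z.2 z.2 - bil z.1 z.2 ^+ 2 != 0)))); last first.
  move=> [u v]; rewrite inE /is_frame /= mul_mx_row gram_row_mx.
  have -> : (row_mx (Q *m u) (Q *m v) == row_mx u v) =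
      (Q *m u == u) && (Q *m v == v).
    by apply/eqP/andP => [/eq_row_mx[-> ->]//|[/eqP-> /eqP->]].
  case: (eqVneq u 0) => [->|_] /=; last by rewrite andbT andbA.
  by rewrite !bil0l mul0r expr0n subrr eqxx !andbF.
rewrite -(pair_big_dep (fun u => (Q *m u == u) && (u != 0)) (fun u v =>
   (Q *m v == v) && (bil u u * bil v v - bil u v ^+ 2 != 0)) (fun _ _ => 1%N)) /=.
rewrite (eq_bigr (fun=> (#|F| ^ (2 * n) - #|F| ^ (2 * n).-1)%N));
  last move=> u /andP[/eqP Qu u0].
  rewrite sum_nat_const; congr (_ * _)%N.
  rewrite -rQ -(card_idempotent_image QQ) (cardsD1 0 [set x | _]) inE mulmx0 eqxx.
  by rewrite add1n subn1; apply: eq_card => u; rewrite !inE andbC.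
rewrite -(card_degenerate_partners sQ rQ Qu u0) -rQ -(card_idempotent_image QQ).
rewrite -(cardsID [set v | bil u u * bil v v - bil u v ^+ 2 == 0]
  [set v | Q *m v == v]).
have -> : #|[set v | (Q *m v == v) && (bil u u * bil v v - bil u v ^+ 2 == 0)]| =
   #|[set v | Q *m v == v] :&: [set v | bil u u * bil v v - bil u v ^+ 2 == 0]|.
  by apply: eq_card => v; rewrite !inE.
by rewrite addKn sum1_card; apply: eq_card => v; rewrite !inE unfold_in andbC.
Qed.

(* Images of these projections are exactly the nondegenerate r-dimensional
   subspaces of the image of Q. *)
Definition proj_set Q r : {set 'M[F]_d} :=
  [set P | [&& selfadj_proj P, Q *m P == P & \rank P == r]].

(** Adding [frame_proj X] is a bijection from the projections inside the orthogonal complement of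
    the frame onto those whose image contains it. *)
Lemma card_proj_set_frame Q r (X : 'M[F]_(d, 1 + 1)) :
    selfadj_proj Q -> is_frame Q X ->
  #|[set P in proj_set Q r.+2 | P *m X == X]| =
  #|proj_set (Q - frame_proj X) r|.
Proof.
move=> sQ /andP[/eqP QX gX]; have sX := frame_proj_selfadj gX.
have QPX := frame_proj_le QX; have [QQ _] := selfadj_projP sQ.
have [XX _] := selfadj_projP sX.
have XQ := proj_le_commute sX sQ QPX.
have sQ' := selfadj_projB sX sQ QPX.
rewrite -[RHS](card_imset _ (addIr (frame_proj X))); apply: eq_card => P.
apply/idP/imsetP => [|[P' P'Q ->]].
  rewrite !inE => /andP[/and3P[sP /eqP QP /eqP rP] /eqP PX].
  have PPX := frame_proj_le PX; exists (P - frame_proj X); last by rewrite subrK.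
  rewrite inE (selfadj_projB sX sP PPX) /=; apply/andP; split.
    rewrite mulmxBl !mulmxBr QP QPX XX (proj_le_commute sX sP PPX).
    by rewrite subrr subr0.
  have := mxrank_projB sX sP PPX; rewrite rP mxrank_frame_proj // => /eqP.
  by rewrite eqSS eqSS eq_sym.
move: P'Q; rewrite [P' \in _]inE => /and3P[sP' /eqP QP' /eqP rP'].
have XP' : frame_proj X *m P' = 0.
  by rewrite -QP' mulmxA mulmxBr XQ XX subrr mul0mx.
have P'X : P' *m frame_proj X = 0.
  have := proj_le_commute sP' sQ' QP' => <-.
  by rewrite -mulmxA mulmxBl QPX XX subrr mulmx0.
have sPX := selfadj_projD sP' sX XP'.
have le_sum : (P' + frame_proj X) *m frame_proj X = frame_proj X.
  by rewrite mulmxDl P'X XX add0r.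
rewrite addrC in sPX.
rewrite !inE sPX /=; apply/andP; split; [apply/andP; split|].
- have {2}<- : Q *m P' = P' by rewrite -[in LHS]QP' mulmxA mulmxBr QQ QPX.
  by rewrite mulmxDr QPX.
- by rewrite (mxrank_projB sX sPX le_sum) mxrank_frame_proj // addrK rP'.
by have /(congr1 (mulmx^~ X)) := le_sum; rewrite -mulmxA frame_projK // => ->.
Qed.

(** Double counting of the pairs [(P, X)] where [X] is a 2-frame in the image of [P]. *)
Lemma card_proj_set_step n a Q : selfadj_proj Q -> \rank Q = (2 * n)%N ->
  (#|proj_set Q (2 * a).+2| * frame_count (2 * a).+2 =
   \sum_(X | is_frame Q X) #|proj_set (Q - frame_proj X) (2 * a)|)%N.
Proof.
move=> sQ rQ; rewrite -sum_nat_const.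
have -> : (2 * a).+2 = (2 * a.+1)%N by lia.
transitivity (\sum_(P in proj_set Q (2 * a.+1)) \sum_(X | is_frame P X) 1)%N.
  apply: eq_bigr => P; rewrite inE => /and3P[sP _ /eqP rP].
  by rewrite -(card_frames sP rP) -sum1_card; apply: eq_bigl => X; rewrite inE.
rewrite (exchange_big_dep (is_frame Q)) /=; last first.
  move=> P X; rewrite inE => /and3P[_ /eqP QP _] /andP[/eqP PX gX].
  by rewrite /is_frame gX -PX mulmxA QP PX eqxx.
apply: eq_bigr => X QX.
have -> : (2 * a.+1)%N = (2 * a).+2 by lia.
rewrite -(card_proj_set_frame _ sQ QX) -sum1_card; apply: eq_bigl => P.
by rewrite inE; have /andP[_ gX] := QX; rewrite /is_frame gX andbT.
Qed.

(** The counting step is iterated: every frame complement has rank [2 * n.-1], and the induction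
    hypothesis gives the same count for each. If [a > n], the right side contains the factor
    [frame_count 0 = 0]. *)
Lemma card_proj_set_prod n a Q : selfadj_proj Q -> \rank Q = (2 * n)%N ->
  (#|proj_set Q (2 * a)| * \prod_(i < a) frame_count (2 * (a - i)) =
   \prod_(i < a) frame_count (2 * (n - i)))%N.
Proof.
elim: a n Q => [|a IHa] n Q sQ rQ.
  rewrite !big_ord0 muln1 muln0 (_ : proj_set Q 0 = [set 0]) ?cards1 //.
  apply/setP => P; rewrite !inE mxrank_eq0.
  apply/idP/idP => [/and3P[]//|/eqP->].
  rewrite mulmx0 !eqxx !andbT; apply/selfadj_projP.
  by rewrite mulmx0 trmx0 mul0mx mulmx0.
rewrite !big_ord_recl !subn0 mulnA.
rewrite (_ : (2 * a.+1)%N = (2 * a).+2) ?(card_proj_set_step _ sQ rQ); last by lia.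
rewrite big_distrl /= -(card_frames sQ rQ) -sum1_card big_distrl /=.
apply: eq_big => [X|X /andP[/eqP QX gX]]; first by rewrite inE.
have sX := frame_proj_selfadj gX; have QPX := frame_proj_le QX.
have rQ' := mxrank_projB sX sQ QPX; rewrite rQ mxrank_frame_proj // in rQ'.
have {}rQ' : \rank (Q - frame_proj X) = (2 * n.-1)%N.
  have : (2 * n = 2 + \rank (Q - frame_proj X)%R)%N := rQ'; lia.
have := IHa _ _ (selfadj_projB sX sQ QPX) rQ'.
rewrite mul1n => IH.
transitivity (\prod_(i < a) frame_count (2 * (n.-1 - i)))%N.
  by rewrite -IH; congr (_ * _)%N; apply: eq_bigr => i _; rewrite /bump.
by apply: eq_bigr => i _; rewrite /bump /= add1n -subn1 -subnDA add1n.
Qed.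

(** * Involutive isometries as self-adjoint projections *)

Lemma bil_eq (A B : 'M[F]_d) :
  (forall x y, (x^T *m A *m y) 0 0 = (x^T *m B *m y) 0 0) -> A = B.
Proof.
move=> AB; apply/matrixP => i j; have := AB (delta_mx i 0) (delta_mx j 0).
by rewrite !trmx_delta -!rowE -!colE !mxE.
Qed.

(** By polarization an isometry satisfies [A^T J A = J]; since [A] is its own inverse, this is
    self-adjointness. *)
Lemma isometryP (qf : 'cV[F]_d -> F) (A : 'M[F]_d) :
  (forall x, bil x x = qf x *+ 2) -> A *m A = 1%:M ->
  (A \in isometries qf) = (A^T *m J == J *m A).
Proof.
move=> qfE AA; have qf_inj x y : (qf x == qf y) = (bil x x == bil y y).
  by rewrite !qfE -!(mulr_natr (qf _)) (inj_eq (mulIf (two_neq0 odd_F))).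
rewrite inE (proj1 (mulmx1_unit AA)) /=; apply/forallP/eqP => [iso|AJ x]; last first.
  rewrite qf_inj /bil trmx_mul -[_ *m A^T *m J]mulmxA AJ !mulmxA.
  by rewrite -[_ *m A *m A]mulmxA AA mulmx1.
have {}iso x : bil (A *m x) (A *m x) = bil x x by apply/eqP; rewrite -qf_inj.
have AJA : A^T *m J *m A = J.
  apply: bil_eq => x y; rewrite !mulmxA -trmx_mul -mulmxA.
  rewrite -/(bil (A *m x) (A *m y)) -/(bil x y).
  have := iso (x + y); rewrite mulmxDr !bilDl !bilDr !iso.
  rewrite !addrA => /addIr; rewrite -!addrA => /addrI.
  rewrite [bil (A *m y) _]bilC [bil y x]bilC -!mulr2n -!(mulr_natr (bil _ _)).
  by move/(mulIf (two_neq0 odd_F)).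
by rewrite -{2}AJA -mulmxA AA mulmx1.
Qed.

(** The map [P |-> 1 - 2 P], with inverse [A |-> (1 - A) / 2], matches self-adjoint projections with
    involutions; determinant [1] selects even rank. *)
Lemma ninvol_special_isometries (qf : 'cV[F]_d -> F) n : d = (2 * n)%N ->
  (forall x, bil x x = qf x *+ 2) ->
  ninvol [set A in isometries qf | \det A == 1] =
  (\sum_(a < n.+1) #|proj_set 1%:M (2 * a)|)%N.
Proof.
move=> dE qfE; have two0 := two_neq0 odd_F.
have refl_inj : injective (fun P : 'M[F]_d => 1%:M - P *+ 2).
  move=> P P' /addrI/oppr_inj; rewrite -!scaler_nat.
  by move/(can_inj (scalerK two0)).
transitivity #|[set P : 'M[F]_d | selfadj_proj P && ~~ odd (\rank P)]|.
  rewrite /ninvol -[RHS](card_imset _ refl_inj); apply: eq_card => A.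
  have det_even P : P *m P = P -> (\det (1%:M - P *+ 2) == 1) = ~~ odd (\rank P).
    move=> /det_reflection->; rewrite -signr_odd; case: odd; last by rewrite eqxx.
    by rewrite expr1 eqr_oppLR -subr_eq0 opprK (negPf two0).
  have invol P : ((1%:M - P *+ 2) *m (1%:M - P *+ 2) == 1%:M) = (P *m P == P).
    rewrite mulmxBl !mulmxBr !mulmx1 mul1mx -subr_eq0.
    have -> : 1%:M - P *+ 2 - (P *+ 2 - P *+ 2 *m (P *+ 2)) - 1%:M =
        (4%:R : F) *: (P *m P - P).
      rewrite -!scaler_nat -scalemxAl -scalemxAr.
      apply/matrixP => i j; rewrite !mxE; ring.
    rewrite scaler_eq0 subr_eq0 -[4%N]/(2 * 2)%N natrM mulf_eq0 (negPf two0) //.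
  have adj P : ((1%:M - P *+ 2)^T *m J == J *m (1%:M - P *+ 2)) =
      (P^T *m J == J *m P).
    rewrite -!scaler_nat linearB /= trmx1 linearZ /= mulmxBl mulmxBr mul1mx mulmx1.
    rewrite -scalemxAl -scalemxAr (inj_eq (addrI _)) (inj_eq oppr_inj).
    by rewrite (inj_eq (can_inj (scalerK two0))).
  apply/idP/imsetP => [|[P]]; last first.
    rewrite [P \in _]inE => /andP[/andP[PP PJ] evP] ->; rewrite inE inE -andbA.
    have AA := PP; rewrite -invol in AA; rewrite AA.
    by rewrite (det_even _ (eqP PP)) evP (isometryP qfE (eqP AA)) adj PJ.
  rewrite inE inE => /andP[/andP[isoA detA] AA].
  pose P : 'M[F]_d := (2%:R^-1 : F) *: (1%:M - A).
  have AE : A = 1%:M - P *+ 2 by rewrite -scaler_nat scalerKV ?subKr.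
  exists P => //; rewrite inE /selfadj_proj -invol -adj -AE AA /=.
  rewrite (isometryP qfE) in isoA; last exact/eqP.
  rewrite isoA /= -det_even -?AE //; apply/eqP; by rewrite -invol -AE.
rewrite -sum1_card.
rewrite (partition_big (fun P => inord (\rank P)./2 : 'I_n.+1) predT) //=.
apply: eq_bigr => a _; rewrite sum1_card; apply: eq_card => P.
rewrite !inE unfold_in /= inE mul1mx eqxx /= -andbA; apply: andb_id2l => _.
have rP : ((\rank P)./2 < n.+1)%N.
  by have := rank_leq_row P; rewrite [X in (_ <= X)%N]dE; lia.
apply/andP/eqP => [[ev /eqP/(congr1 val)]|rPE].
  rewrite /= inordK // => <-; by rewrite mul2n even_halfK.
rewrite rPE mul2n odd_double /=; split=> //; apply/eqP/val_inj.
by rewrite /= inordK doubleK.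
Qed.
End SelfAdjointProjections.

(** * The forms [qform] *)

Section GramMatrix.
Variables (F : finFieldType) (delta : F) (eps : sign) (n : nat).

Definition hyperbolic_pair (i : 'I_n) : bool :=
  if eps is Plus then true else (i.+1 < n)%N.

(** A block of the polar form, for which [bil x x] is twice the quadratic form; hence the factors
    [2] on the diagonal. *)
Definition pair_gram (i : 'I_n) : 'M[F]_(2 * n) :=
  if hyperbolic_pair i then
    delta_mx (ofst i) (osnd i) + delta_mx (osnd i) (ofst i)
  else 2%:R *: delta_mx (ofst i) (ofst i)
    - (2%:R * delta) *: delta_mx (osnd i) (osnd i).

Definition qform_gram : 'M[F]_(2 * n) := \sum_i pair_gram i.

Lemma qform_gram_sym : qform_gram^T = qform_gram.
Proof.
rewrite /qform_gram raddf_sum; apply: eq_bigr => i _ /=; rewrite /pair_gram.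
case: ifP => _; first by rewrite linearD /= !trmx_delta addrC.
by rewrite linearB /= !linearZ /= !trmx_delta.
Qed.

Lemma bil_delta_mx (x : 'cV[F]_(2 * n)) i j :
  (x^T *m delta_mx i j *m x) 0 0 = x i 0 * x j 0.
Proof.
rewrite -[delta_mx i j](mul_delta_mx (0 : 'I_1)) mulmxA -colE -mulmxA -rowE.
by rewrite !mxE big_ord1 !mxE.
Qed.

Lemma qform_gramE x : bil qform_gram x x = qform delta eps x *+ 2.
Proof.
have -> : qform delta eps x = \sum_(i < n) if hyperbolic_pair i
    then x (ofst i) 0 * x (osnd i) 0
    else x (ofst i) 0 ^+ 2 - delta * x (osnd i) 0 ^+ 2.
  rewrite /hyperbolic_pair; case: eps => //=.
  rewrite /qform_minus [RHS](bigID (fun i : 'I_n => (i.+1 < n)%N)) /=; congr (_ + _).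
    by apply: eq_bigr => i ->.
  apply: eq_big => [i|i /eqP iE]; last by rewrite ifN // -leqNgt iE.
  by rewrite -leqNgt eqn_leq; have := ltn_ord i; lia.
rewrite -sumrMnl /bil /qform_gram mulmx_sumr mulmx_suml summxE.
apply: eq_bigr => i _; rewrite /pair_gram; case: ifP => _.
  by rewrite mulmxDr mulmxDl mxE !bil_delta_mx; ring.
rewrite mulmxBr mulmxBl -!scalemxAr -!scalemxAl.
rewrite [LHS]mxE [X in _ + X]mxE [X in X - _]mxE [X in _ - X]mxE !bil_delta_mx.
by ring.
Qed.

Hypotheses (odd_F : odd #|F|) (delta_neq0 : delta != 0).

(** The matrix is block diagonal along the coordinate pairs, with block determinants [-1] or
    [-4 delta]; the proof shows that the left kernel is zero, one pair at a time. *)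
Lemma qform_gram_unit : qform_gram \in unitmx.
Proof.
have two0 := two_neq0 odd_F.
have f_neq_s (i j : 'I_n) : (ofst i == osnd j) = false.
  by apply/negP => /eqP/(congr1 val) /=; lia.
have s_neq_f (i j : 'I_n) : (osnd i == ofst j) = false by rewrite eq_sym.
have ff (i j : 'I_n) : (ofst i == ofst j) = (i == j).
  by apply/eqP/eqP => [/(congr1 val) /= E|-> //]; apply/val_inj => /=; lia.
have ss (i j : 'I_n) : (osnd i == osnd j) = (i == j).
  by apply/eqP/eqP => [/(congr1 val) /= E|-> //]; apply/val_inj => /=; lia.
rewrite -row_free_unit; apply: inj_row_free => v vJ.
have delta_mulE a b j : (v *m delta_mx a b) 0 j = v 0 a * (j == b)%:R.
  rewrite -[delta_mx a b](mul_delta_mx (0 : 'I_1)) mulmxA -colE.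
  by rewrite !mxE big_ord1 !mxE eqxx.
have pairE i j : (v *m pair_gram i) 0 j = if hyperbolic_pair i
    then v 0 (ofst i) * (j == osnd i)%:R + v 0 (osnd i) * (j == ofst i)%:R
    else 2%:R * (v 0 (ofst i) * (j == ofst i)%:R)
      - 2%:R * delta * (v 0 (osnd i) * (j == osnd i)%:R).
  rewrite /pair_gram; case: ifP => _; first by rewrite mulmxDr mxE !delta_mulE.
  rewrite mulmxBr -!scalemxAr [LHS]mxE [X in _ + X]mxE [X in X - _]mxE.
  by rewrite [X in _ - X]mxE !delta_mulE.
have entry j k : (forall i, i != k -> (v *m pair_gram i) 0 j = 0) ->
    (v *m pair_gram k) 0 j = 0.
  move=> h; have := congr1 (fun w : 'rV_(2 * n) => w 0 j) vJ.
  rewrite /qform_gram mulmx_sumr summxE (bigD1 k) //= big1 // addr0 => ->.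
  by rewrite mxE.
have pair0 k : v 0 (ofst k) = 0 /\ v 0 (osnd k) = 0.
  have Ef : (v *m pair_gram k) 0 (ofst k) = 0.
    apply: entry => i /negPf ik; rewrite pairE f_neq_s ff eq_sym ik !mulr0 addr0.
    by rewrite subr0 if_same.
  have Es : (v *m pair_gram k) 0 (osnd k) = 0.
    apply: entry => i /negPf ik; rewrite pairE s_neq_f ss eq_sym ik !mulr0 addr0.
    by rewrite subr0 if_same.
  move: Ef Es; rewrite !pairE f_neq_s s_neq_f !eqxx !mulr0 !mulr1.
  rewrite add0r addr0 subr0 sub0r.
  case: ifP => _ // /eqP; rewrite mulf_eq0 (negPf two0) => /eqP-> /eqP.
  by rewrite oppr_eq0 !mulf_eq0 (negPf two0) (negPf delta_neq0) => /eqP->.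
apply/rowP => j; rewrite [RHS]mxE.
have j2 : (j./2 < n)%N by have := ltn_ord j; lia.
have [ev|od] := boolP (odd j).
  by rewrite (_ : j = osnd (Ordinal j2)) ?(pair0 _).2 //; apply/val_inj => /=; lia.
by rewrite (_ : j = ofst (Ordinal j2)) ?(pair0 _).1 //; apply/val_inj => /=; lia.
Qed.

End GramMatrix.

(** * Gaussian binomials *)

Section QBinomials.
Variable R : realFieldType.
Implicit Types x y z p : R.

(** The q-Pochhammer symbol [(y; y)_n]. *)
Definition qpoch y n : R := \prod_(i < n) (1 - y ^+ i.+1).

(** Gaussian binomials by the q-Pascal rule, which avoids dividing by [qpoch]. *)
Fixpoint qbin y n k : R :=
  match n, k with
  | _, 0 => 1
  | 0, _.+1 => 0
  | n'.+1, k'.+1 => qbin y n' k' + y ^+ k'.+1 * qbin y n' k'.+1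
  end.
Arguments qbin : simpl never.

Lemma qbin0 y n : qbin y n 0 = 1. Proof. by case: n. Qed.

Lemma qbinS y n k :
  qbin y n.+1 k.+1 = qbin y n k + y ^+ k.+1 * qbin y n k.+1.
Proof. by []. Qed.

Lemma qbin_small y n k : (n < k)%N -> qbin y n k = 0.
Proof.
elim: n k => [|n IHn] [|k] // nk.
by rewrite qbinS !IHn ?mulr0 ?addr0 // ltnW.
Qed.

Lemma qpochS y n : qpoch y n.+1 = qpoch y n * (1 - y ^+ n.+1).
Proof. by rewrite /qpoch big_ord_recr. Qed.

(** Induction along Pascal's rule, closed by [(1 - y^(k+1)) + y^(k+1) (1 - y^(m+1)) = 1 -
    y^(m+k+2)]. *)
Lemma qbin_qpoch y m k :
  qbin y (m + k) k * qpoch y k * qpoch y m = qpoch y (m + k).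
Proof.
elim: k m => [|k IHk] m; first by rewrite addn0 qbin0 /qpoch big_ord0 !mul1r.
elim: m => [|m IHm].
  rewrite add0n qbinS (@qbin_small y k k.+1) // mulr0 addr0 qpochS mulrA.
  by have := IHk 0%N; rewrite add0n /qpoch big_ord0 !mulr1 => ->.
rewrite addnS qbinS [qpoch y (m.+1 + k).+1]qpochS mulrDl mulrDl.
rewrite [X in X + _](_ : _ = qpoch y (m.+1 + k) * (1 - y ^+ k.+1)); last first.
  by rewrite -(IHk m.+1) [qpoch y k.+1]qpochS; ring.
rewrite addSnnS.
rewrite [X in _ + X](_ : _ = y ^+ k.+1 * qpoch y (m + k.+1) * (1 - y ^+ m.+1)).
  by rewrite (_ : (m + k.+1).+1 = (k.+1 + m.+1)%N) ?exprD; [ring | lia].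
by rewrite -IHm [qpoch y m.+1]qpochS; ring.
Qed.

(** Peeling off the factor [1 + x] leaves the same product at [x * y]; Pascal's rule recombines the
    coefficients. *)
Lemma qbinomial_theorem y x n :
  \prod_(i < n) (1 + x * y ^+ i) =
  \sum_(k < n.+1) qbin y n k * y ^+ 'C(k, 2) * x ^+ k.
Proof.
elim: n x => [|n IHn] x; first by rewrite big_ord0 big_ord1 /= bin0n !mulr1.
rewrite big_ord_recl expr0 mulr1.
under eq_bigr => i _ do rewrite lift0 exprS mulrA.
rewrite IHn mulrDl mul1r [in RHS]big_ord_recl.
rewrite [X in X + _ = _]big_ord_recl -addrA; congr (_ + _); first by rewrite !qbin0.
rewrite mulr_sumr.
have -> : \sum_(i < n) qbin y n (lift ord0 i) * y ^+ 'C(lift ord0 i, 2)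
      * (x * y) ^+ lift ord0 i =
    \sum_(i < n.+1) qbin y n i.+1 * y ^+ 'C(i.+1, 2) * (x * y) ^+ i.+1.
  rewrite [RHS]big_ord_recr /= (@qbin_small y n n.+1) // !mul0r addr0.
  by apply: eq_bigr.
rewrite -big_split /=; apply: eq_bigr => i _.
rewrite -[bump 0 i]/(i.+1) qbinS binS bin1 exprD !exprMn !exprS; ring.
Qed.

Lemma prod_odd_exp p n : \prod_(i < n) p ^+ (2 * i).+1 = p ^+ (n ^ 2).
Proof.
elim: n => [|n IHn]; first by rewrite big_ord0.
by rewrite big_ord_recr /= IHn -exprD; congr (_ ^+ _); rewrite -!mulnn; lia.
Qed.

(** The gap is [(n - k)^2], so the truncated exponent [n ^ 2 - k * (2 * n - k)] used below is this
    square. *)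
Lemma leq_mul_sub_sqr n k : (k <= 2 * n)%N -> (k * (2 * n - k) <= n ^ 2)%N.
Proof.
by move=> kn; have [] := nat_AGM2 k (2 * n - k); rewrite subnKC // expnMn leq_pmul2l.
Qed.

Lemma mul2_bin2 k : (2 * 'C(k, 2) + k = k ^ 2)%N.
Proof. by elim: k => // k IHk; rewrite binS bin1 -!mulnn in IHk *; lia. Qed.

(* The q-binomial theorem at y = p^2, recentred at k = n: a finite form of the
   Jacobi triple product. *)
Lemma finite_triple_product p z n : p != 0 -> z ^+ 2 = 1 ->
  z ^+ n * \prod_(i < n) (1 + z * p ^+ (2 * i).+1) ^+ 2 =
  \sum_(k < (2 * n).+1)
    qbin (p ^+ 2) (2 * n) k * p ^+ (n ^ 2 - k * (2 * n - k)) * z ^+ k.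
Proof.
move=> p0 z2; have pn0 m : p ^+ m != 0 by rewrite expf_neq0.
(* The q-binomial theorem is used with [2 * n] factors at [x = z p^(1-2n)]. *)
transitivity (p ^+ (n ^ 2) *
  \prod_(i < 2 * n) (1 + z * p * p ^- (2 * n) * (p ^+ 2) ^+ i)); last first.
  rewrite qbinomial_theorem mulr_sumr; apply: eq_bigr => k _.
  have -> : p ^+ (n ^ 2 - k * (2 * n - k)) =
      p ^+ (n ^ 2) * (p ^+ 2) ^+ 'C(k, 2) * p ^+ k / p ^+ (2 * n * k).
    apply: (canRL (mulfK (pn0 _))); rewrite -exprM -!exprD; congr (_ ^+ _).
    have kn : (k <= 2 * n)%N by rewrite -ltnS.
    have := leq_mul_sub_sqr kn; have := mul2_bin2 k; move: kn; nia.
  rewrite (exprMn _ (z * p)) (exprMn _ z) exprVn -(exprM p (2 * n)); ring.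
rewrite mul2n -addnn big_split_ord /=.
have -> : \prod_(i < n) (1 + z * p * p ^- (n + n) * (p ^+ 2) ^+ (n + i)) =
    \prod_(i < n) (1 + z * p ^+ (2 * i).+1).
  apply: eq_bigr => i _; congr (_ + _); rewrite -!mulrA; congr (_ * _).
  rewrite -exprM (_ : (2 * (n + i) = (n + n) + 2 * i)%N); last lia.
  by rewrite (exprD p (n + n)) exprS mulKf.
(* Reversed, the lower half has factors [1 + z p^-(2i+1) = z p^-(2i+1) (1 + z p^(2i+1))], by
   [z^2 = 1]. *)
rewrite [X in _ = _ * (X * _)](reindex_inj rev_ord_inj) /=.
have -> : \prod_(i < n) (1 + z * p * p ^- (n + n) * (p ^+ 2) ^+ (n - i.+1)) =
    z ^+ n / p ^+ (n ^ 2) * \prod_(i < n) (1 + z * p ^+ (2 * i).+1).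
  rewrite -prod_odd_exp -prodfV -[in z ^+ n](card_ord n) -prodr_const -!big_split /=.
  apply: eq_bigr => i _; rewrite mulrDr mulr1 addrC; congr (_ + _).
    rewrite -!mulrA; congr (_ * _); rewrite -exprM.
    have -> : p ^+ (n + n) = p ^+ (2 * (n - i.+1)) * p ^+ (2 * i).+1 * p.
      by rewrite -exprD -exprSr; congr (_ ^+ _); have := ltn_ord i; lia.
    by field; rewrite p0 !pn0.
  by rewrite mulrACA -expr2 z2 mul1r mulVf // expf_neq0.
by rewrite prodrXl; field; rewrite pn0.
Qed.

End QBinomials.

(** * Even-index sums, normalized subspace counts, and bounds on [qpoch] *)

Section Asymptotics.
Variable R : realFieldType.
Implicit Types x y z p : R.

Lemma sum_even_indices n (g : nat -> R) :
  \sum_(k < (2 * n).+1) g k * (1 + (-1) ^+ k) = 2 * \sum_(a < n.+1) g (2 * a)%N.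
Proof.
elim: n => [|n IHn]; first by rewrite muln0 !big_ord1 expr0 mulrC.
rewrite (_ : (2 * n.+1).+1 = (2 * n).+3); last lia.
rewrite 2!big_ord_recr IHn [in RHS]big_ord_recr /= mulrDr.
have sgn : (-1) ^+ (2 * n) = 1 :> R by rewrite exprM sqrrN expr1n expr1n.
rewrite !exprS sgn (_ : (2 * n.+1)%N = (2 * n).+2); last lia.
ring.
Qed.

(** Adding the finite triple products at [z = 1] and [z = -1] cancels the odd indices. *)
Lemma triple_product_even p n : p != 0 ->
  \prod_(i < n) (1 + p ^+ (2 * i).+1) ^+ 2 +
    (-1) ^+ n * \prod_(i < n) (1 - p ^+ (2 * i).+1) ^+ 2 =
  2 * \sum_(a < n.+1) qbin (p ^+ 2) (2 * n) (2 * a)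
       * p ^+ (n ^ 2 - 2 * a * (2 * n - 2 * a)).
Proof.
move=> p0; have N1 : (-1) ^+ 2 = 1 :> R by rewrite sqrrN expr1n.
rewrite -(sum_even_indices n (fun k => qbin (p ^+ 2) (2 * n) k
  * p ^+ (n ^ 2 - k * (2 * n - k)))).
under [RHS]eq_bigr => k _ do rewrite mulrDr mulr1.
rewrite [RHS]big_split /= -(finite_triple_product n p0 N1); congr (_ + _); last first.
  by congr (_ * _); apply: eq_bigr => i _; rewrite mulN1r.
transitivity (1 ^+ n * \prod_(i < n) (1 + 1 * p ^+ (2 * i).+1) ^+ 2).
  by rewrite expr1n mul1r; apply: eq_bigr => i _; rewrite mul1r.
rewrite (finite_triple_product n p0 (expr1n R 2)).
by apply: eq_bigr => k _; rewrite expr1n mulr1.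
Qed.

Lemma prod_qpoch y m a :
  (\prod_(i < a) (1 - y ^+ (m + a - i))) * qpoch y m = qpoch y (m + a).
Proof.
elim: a => [|a IHa]; first by rewrite big_ord0 mul1r addn0.
rewrite big_ord_recl subn0 addnS qpochS -IHa /=.
by rewrite -mulrA [RHS]mulrC.
Qed.

Lemma qpoch_neq0 y n : 0 < y < 1 -> qpoch y n != 0.
Proof.
move=> /andP[y0 y1]; apply/prodf_neq0 => i _; rewrite subr_eq0 eq_sym.
by rewrite lt_eqF // exprn_ilt1 // ltW.
Qed.

(** Here [f (2j) = q^(4j) (1 - y^j) (1 - p)], so the quotient of the two products is [q^(4a(n-a))]
    times the Gaussian binomial, and [n^2 - 4a(n-a) = (n-2a)^2]. *)
Lemma qbin_ratio_count q a n t : (1 < q)%N -> (a <= n)%N ->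
  let f D := ((q ^ D - 1) * (q ^ D - q ^ D.-1))%N in
  (t * \prod_(i < a) f (2 * (a - i)) = \prod_(i < a) f (2 * (n - i)))%N ->
  t%:R / q%:R ^+ (n ^ 2) =
    qbin ((q%:R^-1) ^+ 2) n a * q%:R^-1 ^+ (n ^ 2 - 2 * a * (2 * n - 2 * a)) :> R.
Proof.
move=> q1 an f tE; set p : R := q%:R^-1; set y := p ^+ 2.
have q0 : q%:R != 0 :> R by rewrite pnatr_eq0 -lt0n ltnW.
have p01 : 0 < p < 1.
  by rewrite invr_gt0 ltr0n ltnW //= invf_lt1 ?ltr1n // ltr0n ltnW.
have y01 : 0 < y < 1.
  have /andP[p0 p1] := p01; by rewrite exprn_gt0 //= exprn_ilt1 // ltW.
have fE j : (f (2 * j)%N)%:R = q%:R ^+ (4 * j) * (1 - y ^+ j) * (1 - p) :> R.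
  rewrite /f; case: j => [|j].
    by rewrite muln0 expn0 subnn mul0n expr0 [1 - 1]subrr mulr0 mul0r.
  have -> : (4 * j.+1 = (2 * j).+2 + (2 * j).+2)%N by lia.
  have -> : (2 * j.+1 = (2 * j).+2)%N by lia.
  rewrite natrM natrB ?expn_gt0 ?(ltnW q1) // natrB ?leq_exp2l ?leq_pred //.
  rewrite succnK !natrX /y -exprM (_ : (2 * j.+1 = (2 * j).+2)%N); last lia.
  rewrite (exprD _ (2 * j).+2) /p exprVn !(exprS _ (2 * j).+1).
  by field; rewrite q0 expf_neq0.
have [m nE] : exists m, n = (m + a)%N by exists (n - a)%N; rewrite subnK.
have p1 : 1 - p != 0 by have /andP[_ p1] := p01; rewrite subr_eq0 eq_sym lt_eqF.
have prodE k : (\prod_(i < a) f (2 * (k + a - i)))%:R =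
    q%:R ^+ (4 * k * a) * (\prod_(i < a) q%:R ^+ (4 * (a - i))) *
    (\prod_(i < a) (1 - y ^+ (k + a - i))) * (1 - p) ^+ a :> R.
  rewrite natr_prod (exprM _ (4 * k)) -[in X in X * _ * _ * _](card_ord a).
  rewrite -[in (1 - p) ^+ a](card_ord a).
  rewrite -!prodr_const -!big_split /=; apply: eq_bigr => i _.
  by rewrite fE -exprD; congr (_ ^+ _ * _ * _); have := ltn_ord i; lia.
have := congr1 (fun k => k%:R : R) tE; rewrite natrM nE prodE.
have -> : (\prod_(i < a) f (2 * (a - i)) = \prod_(i < a) f (2 * (0 + a - i)))%N by [].
rewrite prodE muln0 mul0n expr0 mul1r.
have -> : \prod_(i < a) (1 - y ^+ (0 + a - i)) = qpoch y a.
  by rewrite -(prod_qpoch y 0 a) /qpoch big_ord0 mulr1.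
set W := \prod_(i < a) q%:R ^+ _.
have W0 : W != 0 by apply/prodf_neq0 => i _; rewrite expf_neq0.
move=> tE'.
have {}tE' : t%:R * qpoch y a * qpoch y m =
    q%:R ^+ (4 * m * a) * qpoch y (m + a).
  apply: (mulfI (mulf_neq0 W0 (expf_neq0 a p1))); rewrite -(prod_qpoch y m a).
  rewrite [LHS](_ : _ = t%:R * (W * qpoch y a * (1 - p) ^+ a) * qpoch y m);
    last by ring.
  by rewrite tE'; ring.
have -> : q%:R ^+ ((m + a) ^ 2) = q%:R ^+ (4 * m * a) *
    q%:R ^+ ((m + a) ^ 2 - 2 * a * (2 * (m + a) - 2 * a)) :> R.
  rewrite -exprD; congr (_ ^+ _).
  have : (2 * a <= 2 * (m + a))%N by lia.
  by move/leq_mul_sub_sqr; lia.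
move: tE'; rewrite -(qbin_qpoch y m a) => tE'.
have {}tE' : t%:R = q%:R ^+ (4 * m * a) * qbin y (m + a) a.
  apply: (mulIf (qpoch_neq0 a y01)); apply: (mulIf (qpoch_neq0 m y01)).
  by rewrite tE'; ring.
by rewrite tE' /p exprVn; field; rewrite !expf_neq0.
Qed.

Lemma qpoch_ge0 y n : 0 <= y <= 1 -> 0 <= qpoch y n.
Proof.
move=> /andP[y0 y1]; apply: prodr_ge0 => i _; rewrite subr_ge0.
exact: exprn_ile1.
Qed.

Lemma qpoch_le1 y n : 0 <= y <= 1 -> qpoch y n <= 1.
Proof.
move=> /andP[y0 y1]; apply: prodr_ile1 => i _.
by rewrite subr_ge0 exprn_ile1 //= gerBl exprn_ge0.
Qed.

(** Each new factor lowers [qpoch] by at most [y^(l+m+1)], which is at most the increment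
    [y^(l+m) (1 - y) / 2] of the bound exactly because [3 y <= 1]. *)
Lemma qpoch_diff y l m : 0 <= y -> 3 * y <= 1 ->
  0 <= qpoch y l - qpoch y (l + m) <= y ^+ l * (1 - y ^+ m) / 2.
Proof.
move=> y0 y3; have y1 : 0 <= y <= 1 by lra.
elim: m => [|m /andP[IH0 IH1]].
  by rewrite addn0 subrr expr0 subrr mulr0 mul0r lexx.
rewrite addnS qpochS.
have A0 := qpoch_ge0 (l + m) y1; have A1 := qpoch_le1 (l + m) y1.
have P0 : 0 <= y ^+ (l + m).+1 by rewrite exprn_ge0.
have M : qpoch y (l + m) * y ^+ (l + m).+1 <= y ^+ (l + m).+1 by rewrite ler_piMl.
have M0 : 0 <= qpoch y (l + m) * y ^+ (l + m).+1 by rewrite mulr_ge0.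
have T : y * y ^+ (l + m) * 3 <= y ^+ (l + m).
  by rewrite mulrAC [y * 3]mulrC ler_piMl // exprn_ge0.
rewrite mulrBr mulr1; rewrite exprS in P0 M M0 *; rewrite [y ^+ m.+1]exprS.
rewrite exprD in IH1 M M0 P0 T *.
lra.
Qed.

Lemma qpoch_ge_half y n : 0 <= y -> 3 * y <= 1 -> 2^-1 <= qpoch y n.
Proof.
move=> y0 y3; have := qpoch_diff 0 n y0 y3; rewrite add0n /qpoch big_ord0 expr0.
have : 0 <= y ^+ n by rewrite exprn_ge0.
lra.
Qed.

End Asymptotics.

(** * Comparing the Gaussian binomials [[n, a]] and [[2n, 2a]] *)

Section Comparison.
Variable R : realFieldType.
Implicit Types x y z p : R.

(** Over the common denominator [B C B' C' >= 1/16], the numerator of [X - X'] is a term in [[0, e]]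
    minus one in [[0, 2e]]; hence [32 = 2 * 16]. *)
Lemma quotient_diff (A B C A' B' C' X X' e : R) :
    X * B * C = A -> X' * B' * C' = A' ->
    2^-1 <= B <= 1 -> 2^-1 <= C -> 2^-1 <= B' <= 1 -> 2^-1 <= C' <= 1 ->
    0 <= A' <= 1 -> 0 <= A - A' <= e -> 0 <= B - B' <= e -> 0 <= C - C' <= e ->
  `|X - X'| <= 32 * e.
Proof.
move=> XE X'E /andP[B2 B1] C2 /andP[B'2 B'1] /andP[C'2 C'1] /andP[A'0 A'1].
move=> /andP[dA0 dA1] /andP[dB0 dB1] /andP[dC0 dC1].
have half_gt0 : 0 < 2^-1 :> R by rewrite invr_gt0 ltr0n.
have half_ge0 := ltW half_gt0.
have B0 := le_trans half_ge0 B2; have B'0 := le_trans half_ge0 B'2.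
have C0 := le_trans half_ge0 C2; have C'0 := le_trans half_ge0 C'2.
have quarter (u v : R) : 2^-1 <= u -> 2^-1 <= v -> 4^-1 <= u * v.
  move=> u2 v2; rewrite (_ : 4^-1 = 2^-1 * 2^-1) ?ler_pM //.
  by rewrite -invfM -natrM.
have D16 : 16^-1 <= B * C * (B' * C').
  have q0 : 0 <= 4^-1 :> R by rewrite invr_ge0 ler0n.
  by rewrite (_ : 16^-1 = 4^-1 * 4^-1) ?ler_pM ?quarter // -invfM -natrM.
have NE : (X - X') * (B * C * (B' * C')) =
    (A - A') * (B' * C') - A' * ((B - B') * C' + B * (C - C')).
  by rewrite -XE -X'E; ring.
have T1 : 0 <= (A - A') * (B' * C') <= e.
  rewrite !mulr_ge0 //= (le_trans (ler_piMr _ _) dA1) //.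
  exact: mulr_ile1.
have T2 : 0 <= A' * ((B - B') * C' + B * (C - C')) <= 2 * e.
  rewrite mulr_ge0 ?addr_ge0 ?mulr_ge0 //=.
  rewrite (le_trans (ler_piMl _ A'1)) ?addr_ge0 ?mulr_ge0 //.
  rewrite mulr_natl mulr2n lerD //.
    by rewrite (le_trans (ler_piMr dB0 C'1)).
  by rewrite (le_trans (ler_piMl dC0 B1)).
have N1 : `|(X - X') * (B * C * (B' * C'))| <= 2 * e.
  rewrite NE; move: T1 T2.
  by rewrite ler_norml; lra.
have : `|X - X'| * 16^-1 <= 2 * e.
  apply: le_trans N1; rewrite normrM ler_wpM2l //.
  exact: le_trans (ler_norm _).
by rewrite ler_pdivrMr ?ltr0n // mulrAC -natrM.
Qed.

Lemma qbin_diff y m a : 0 < y -> 3 * y <= 1 ->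
  `|qbin y (m + a) a - qbin y (2 * (m + a)) (2 * a)| <= 16 * y ^+ minn m a.
Proof.
move=> y0 y3; have y0' := ltW y0; have y1 : y <= 1 by lra.
have diff l : (minn m a <= l)%N ->
    0 <= qpoch y l - qpoch y (2 * l) <= y ^+ minn m a / 2.
  move=> ml; have /andP[d0 d1] := qpoch_diff l l y0' y3.
  rewrite mul2n -addnn d0 (le_trans d1) // ler_wpM2r ?invr_ge0 ?ler0n //.
  rewrite (le_trans (ler_piMr _ _)) ?exprn_ge0 // ?gerBl ?exprn_ge0 //.
  exact: ler_wiXn2l.
have bounds l : 2^-1 <= qpoch y l <= 1.
  by rewrite qpoch_ge_half // qpoch_le1 // y0' y1.
have half l : 2^-1 <= qpoch y l by have /andP[] := bounds l.
(* The error [e = y ^+ minn m a / 2] bounds [qpoch y l - qpoch y (2 * l)] for [l = m + a], [a] and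
   [m] alike. *)
rewrite (_ : 16 * _ = 32 * (y ^+ minn m a / 2)); last by field.
apply: (quotient_diff (A' := qpoch y (2 * (m + a))) (qbin_qpoch y m a) _
  (bounds a) (half m) (bounds (2 * a)%N)
  (bounds (2 * m)%N)); last 1 first.
- by apply: diff; rewrite geq_minl.
- by rewrite mulnDr qbin_qpoch.
- by rewrite qpoch_ge0 ?qpoch_le1 // y0' y1.
- by apply: diff; rewrite (leq_trans (geq_minl _ _)) ?leq_addr.
by apply: diff; rewrite geq_minr.
Qed.

Lemma involution_sum_bound p n : 0 < p -> 3 * p <= 1 ->
  `|\sum_(a < n.+1) qbin (p ^+ 2) n a * p ^+ (n ^ 2 - 2 * a * (2 * n - 2 * a)) -
    (\prod_(i < n) (1 + p ^+ (2 * i).+1) ^+ 2 +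
      (-1) ^+ n * \prod_(i < n) (1 - p ^+ (2 * i).+1) ^+ 2) / 2| <=
  16 * (n.+1%:R * p ^+ n).
Proof.
move=> p0 p3; have p1 : p <= 1 by lra.
have y0 : 0 < p ^+ 2 by rewrite exprn_gt0.
have y3 : 3 * p ^+ 2 <= 1.
  by rewrite expr2; nra.
rewrite triple_product_even ?gt_eqF // mulrAC divff ?mul1r; last first.
  by rewrite pnatr_eq0.
rewrite -sumrB (le_trans (ler_norm_sum _ _ _)) //.
rewrite mulrCA -[in n.+1%:R](card_ord n.+1) mulr_natl -sumr_const.
apply: ler_sum => -[/= a]; rewrite ltnS => an _.
have [m ->] : exists m, n = (m + a)%N by exists (n - a)%N; rewrite subnK.
rewrite -mulrBl normrM [`|p ^+ _|]ger0_norm ?exprn_ge0 ?(ltW p0) //.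
have pE0 : 0 <= p ^+ ((m + a) ^ 2 - 2 * a * (2 * (m + a) - 2 * a)).
  by rewrite exprn_ge0 // ltW.
apply: le_trans (ler_wpM2r pE0 (qbin_diff m a y0 y3)) _.
rewrite -mulrA ler_wpM2l ?ler0n // -exprM -exprD.
rewrite ler_wiXn2l ?(ltW p0) //.
have ma : (2 * a <= 2 * (m + a))%N by lia.
(* The exponent is [2 min(m, a) + (m - a)^2], at least [2 min(m, a) + |m - a| = m + a]. *)
have := leq_mul_sub_sqr ma; have [le_ma|le_am] := leqP m a; nia.
Qed.

End Comparison.

Local Open Scope classical_set_scope.

Lemma ninvol_SO_ratio (R : realType) (F : finFieldType) (delta : F) eps n :
    odd #|F| -> delta != 0 -> let p : R := #|F|%:R^-1 in
  (ninvol (SO_group delta eps n))%:R / #|F|%:R ^+ (n ^ 2) =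
  \sum_(a < n.+1) qbin (p ^+ 2) n a * p ^+ (n ^ 2 - 2 * a * (2 * n - 2 * a)).
Proof.
move=> odd_F delta0 p; have Js := qform_gram_sym delta eps n.
have Ju := qform_gram_unit eps n odd_F delta0.
rewrite (ninvol_special_isometries Js Ju odd_F (erefl _)
  (@qform_gramE F delta eps n)).
rewrite natr_sum mulr_suml; apply: eq_bigr => -[a /=]; rewrite ltnS => an _.
apply: qbin_ratio_count => //; first exact: finNzRing_gt1.
apply: (card_proj_set_prod Js Ju odd_F); first exact: selfadj_proj1.
by rewrite mxrank1.
Qed.

(** * Passage to the limit *)

Section Limits.
Variables (R : realType) (q : nat).
Hypothesis q_gt2 : (2 < q)%N.
Let p : R := q%:R^-1.

(** Shifts the products from indices starting at [1] to ordinals starting at [0]. *)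
Lemma cvg_infprod (c d : nat -> R) :
  cvgn (fun N => \prod_(1 <= i < N.+1) c i) -> (forall i, d i = c i.+1) ->
  (fun n => \prod_(i < n) d i) @ \oo --> infprod c.
Proof.
move=> c_cvg dE; rewrite /infprod.
have -> // : (fun n => \prod_(i < n) d i) = (fun N => \prod_(1 <= i < N.+1) c i).
apply/funext => n; rewrite big_add1 big_mkord; apply: eq_bigr => i _; exact: dE.
Qed.

Lemma cvg_plus_products :
  (fun n => \prod_(i < n) (1 + p ^+ (2 * i).+1) ^+ 2) @ \oo -->
  infprod (fun i => (1 + 1 / q%:R ^+ (2 * i - 1)) ^+ 2 : R).
Proof.
apply: (@cvg_infprod (fun i => (1 + 1 / q%:R ^+ (2 * i - 1)) ^+ 2)
  (fun i => (1 + p ^+ (2 * i).+1) ^+ 2)) => [|i].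
  exact: is_cvg_infprod_plus (ltnW q_gt2).
by rewrite div1r /p exprVn (_ : (2 * i.+1 - 1 = (2 * i).+1)%N) //; lia.
Qed.

Lemma cvg_minus_products :
  (fun n => \prod_(i < n) (1 - p ^+ (2 * i).+1) ^+ 2) @ \oo -->
  infprod (fun i => (1 - 1 / q%:R ^+ (2 * i - 1)) ^+ 2 : R).
Proof.
apply: (@cvg_infprod (fun i => (1 - 1 / q%:R ^+ (2 * i - 1)) ^+ 2)
  (fun i => (1 - p ^+ (2 * i).+1) ^+ 2)) => [|i].
  exact: is_cvg_infprod_minus (ltnW q_gt2).
by rewrite div1r /p exprVn (_ : (2 * i.+1 - 1 = (2 * i).+1)%N) //; lia.
Qed.

(** Dominated by [(2 p)^n], since [n + 1 <= 2^n]; here [2 p < 1] because [q > 2]. *)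
Lemma cvg_linear_geometric : (fun n => n.+1%:R * p ^+ n) @ \oo --> 0.
Proof.
have q0 : 0 < q%:R :> R by rewrite ltr0n; lia.
have p0 : 0 <= p by rewrite invr_ge0 ltW.
apply: (squeeze_cvgr (f := fun=> 0) (h := fun n => (2 * p) ^+ n)).
- apply: nearW => n; rewrite mulr_ge0 ?exprn_ge0 ?ler0n //=.
  by rewrite exprMn ler_wpM2r ?exprn_ge0 // -natrX ler_nat ltn_expl.
- exact: cvg_cst.
apply: cvg_expr; rewrite ger0_norm ?mulr_ge0 ?ler0n //.
by rewrite /p ltr_pdivrMr // mul1r ltr_nat.
Qed.

(** Restricting to indices [u m] of fixed parity freezes the sign [(-1) ^+ n]; the two congruence
    classes of the dimension are the two instances. *)
Lemma cvg_involution_sum (S : nat -> R) (u : nat -> nat) (sgn : R) :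
    (forall n, `|S n - (\prod_(i < n) (1 + p ^+ (2 * i).+1) ^+ 2 +
      (-1) ^+ n * \prod_(i < n) (1 - p ^+ (2 * i).+1) ^+ 2) / 2| <=
      16 * (n.+1%:R * p ^+ n)) ->
    u @ \oo --> \oo -> (forall m, (-1) ^+ u m = sgn) ->
  (S \o u) @ \oo -->
    1 / 2 * (infprod (fun i => (1 + 1 / q%:R ^+ (2 * i - 1)) ^+ 2) +
      sgn * infprod (fun i => (1 - 1 / q%:R ^+ (2 * i - 1)) ^+ 2)).
Proof.
move=> bound u_oo sgnE; have Pu := cvg_comp u _ u_oo cvg_plus_products.
have Mu := cvg_comp u _ u_oo cvg_minus_products.
have Eu := cvg_comp u _ u_oo cvg_linear_geometric.
move: Pu Mu Eu; set P := (fun n => _) \o u; set M := (fun n => _) \o u.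
set E := (fun n => _) \o u => Pu Mu Eu.
have err : (fun m => S (u m) - (P m + sgn * M m) / 2) @ \oo --> (0 : R).
  apply: norm_cvg0; apply: (squeeze_cvgr (f := fun=> 0) (h := fun m => 16 * E m)).
  - by apply: nearW => m; rewrite normr_ge0 /= -(sgnE m) bound.
  - exact: cvg_cst.
  by rewrite -[X in _ --> X](mulr0 16); apply: cvgMr.
have -> : S \o u = (fun m => 1 / 2 * (P m + sgn * M m)) \+
    (fun m => S (u m) - (P m + sgn * M m) / 2).
  by apply/funext => m /=; rewrite div1r mulrC addrC subrK.
rewrite -[X in _ --> X]addr0; apply: cvgD => //.
by apply: cvgMr; apply: cvgD => //; apply: cvgMr.
Qed.

End Limits.

Theorem theorem7p1 (R : realType) (F : finFieldType) (q : nat)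
    (card_F : #|F| = q) (odd_q : odd q)
    (delta : F) (delta_nonsquare : forall a : F, a ^+ 2 != delta)
    (eps : sign) :
  (fun m : nat =>
     (ninvol (SO_group delta eps (2 * m)))%:R / q%:R ^+ ((2 * m) ^ 2)%N : R)
    @ \oo -->
  1 / 2 * (infprod (fun i => (1 + 1 / q%:R ^+ (2 * i - 1)) ^+ 2) +
           infprod (fun i => (1 - 1 / q%:R ^+ (2 * i - 1)) ^+ 2))
  /\
  (fun m : nat =>
     (ninvol (SO_group delta eps (2 * m + 1)))%:R
       / q%:R ^+ ((2 * m + 1) ^ 2)%N : R)
    @ \oo -->
  1 / 2 * (infprod (fun i => (1 + 1 / q%:R ^+ (2 * i - 1)) ^+ 2) -
           infprod (fun i => (1 - 1 / q%:R ^+ (2 * i - 1)) ^+ 2)).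
Proof.
have delta0 : delta != 0.
  by have := delta_nonsquare 0; rewrite expr0n eq_sym.
(* An odd field order is at least [3], which provides both [3 p <= 1] and [2 p < 1] for
   [p = 1/q]. *)
have q_gt2 : (2 < q)%N.
  by move: odd_q (finNzRing_gt1 F); rewrite card_F; case: q {card_F} => [|[|[]]].
have odd_F : odd #|F| by rewrite card_F.
have p_gt0 : 0 < q%:R^-1 :> R by rewrite invr_gt0 ltr0n; lia.
have p_le3 : 3 * q%:R^-1 <= 1 :> R.
  by rewrite ler_pdivrMr ?mul1r ?ler_nat // ltr0n; lia.
pose S n : R := (ninvol (SO_group delta eps n))%:R / q%:R ^+ (n ^ 2).
have bound n : `|S n - (\prod_(i < n) (1 + q%:R^-1 ^+ (2 * i).+1) ^+ 2 +
      (-1) ^+ n * \prod_(i < n) (1 - q%:R^-1 ^+ (2 * i).+1) ^+ 2) / 2| <=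
      16 * (n.+1%:R * q%:R^-1 ^+ n).
  rewrite /S -card_F ninvol_SO_ratio // card_F.
  exact: involution_sum_bound.
have sgn_even m : (-1) ^+ (2 * m) = 1 :> R by rewrite exprM sqrrN expr1n expr1n.
have even_oo := @cvg_mulnl 2 isT.
split.
  rewrite -[X in _ * (_ + X)]mul1r.
  exact: (cvg_involution_sum q_gt2 bound even_oo sgn_even).
rewrite -[X in _ * (_ + X)]mulN1r.
apply: (cvg_involution_sum q_gt2 bound (u := fun m => (2 * m + 1)%N)).
  exact: (cvg_comp _ _ even_oo (cvg_addnr 1)).
by move=> m; rewrite exprD sgn_even mul1r.
Qed.
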